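(* For every integer $n\ge 10$, $$\tilde r(P_4,P_n)\le \Big\lceil \frac75 n\Big\rceil -1.$$
   Context: $P_t$ denotes the path on $t$ vertices. For finite graphs $G,H$, the game $\tilde R(G,H)$ is played by Builder and Painter on the infinite complete graph $K_{\mathbb N}$ with vertex set $\mathbb N$: in every round Builder chooses a previously unselected edge of $K_{\mathbb N}$ and Painter colours it red or blue. The game ends when there is a red copy of $G$ or a blue copy of $H$ (as a not necessarily induced subgraph) on the board. Builder aims to finish the game as soon as possible, Painter aims to prolong it. The online size Ramsey number $\tilde r(G,H)$ is the number of rounds in $\tilde R(G,H)$ when both players play optimally, i.e. the least $t$ such that Builder has a strategy guaranteeing that the game ends within at most $t$ rounds whatever Painter does. *)

(* Defs.v *)
From HB Require Import structures.
From mathcomp Require Import all_boot all_order all_algebra.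

Set Implicit Arguments.
Unset Strict Implicit.
Unset Printing Implicit Defensive.

Record sgraph := SGraph {
  vertex :> finType;
  adj : rel vertex;
  adj_sym : symmetric adj;
  adj_irr : irreflexive adj }.

Definition path_adj (t : nat) : rel 'I_t :=
  fun i j => (i.+1 == j) || (j.+1 == i).

Lemma path_adj_sym (t : nat) : symmetric (@path_adj t).
Proof. by move=> i j; rewrite /path_adj orbC. Qed.

Lemma path_adj_irr (t : nat) : irreflexive (@path_adj t).
Proof. by move=> i; rewrite /path_adj orbb (gtn_eqF (ltnSn i)). Qed.

Definition path_graph (t : nat) : sgraph :=
  SGraph (@path_adj_sym t) (@path_adj_irr t).

(* The edges of the complete graph on the natural numbers: the unordered pair
   {u, v}, u != v, is represented by its increasing enumeration. *)
Definition edge := {e : nat * nat | e.1 < e.2}.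

Definition colour := bool.
Definition red : colour := true.
Definition blue : colour := false.

(* The history of the game, most recent round first. *)
Definition board := seq (edge * colour).

Definition selected (b : board) : seq edge := [seq m.1 | m <- b].

Definition joined (b : board) (c : colour) (u v : nat) : bool :=
  has (fun m : edge * colour =>
         (m.2 == c) && ((val m.1 == (u, v)) || (val m.1 == (v, u)))) b.

Definition has_copy (b : board) (c : colour) (G : sgraph) : Prop :=
  exists2 f : G -> nat, injective f &
    forall x y : G, adj x y -> joined b c (f x) (f y).

Definition game_over (G H : sgraph) (b : board) : Prop :=
  has_copy b red G \/ has_copy b blue H.

Definition builder_strategy := board -> edge.
Definition painter_strategy := board -> edge -> colour.

(* Legality is required of all boards, including those on which the game is
   over: as there are infinitely many edges this is no restriction. *)
Definition legal (sigma : builder_strategy) : Prop :=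
  forall b : board, sigma b \notin selected b.

Fixpoint play (sigma : builder_strategy) (pi : painter_strategy) (k : nat) :
    board :=
  if k is k'.+1 then
    let b := play sigma pi k' in (sigma b, pi b (sigma b)) :: b
  else [::].

Definition builder_ends_within (G H : sgraph) (t : nat) : Prop :=
  exists2 sigma : builder_strategy, legal sigma &
    forall pi : painter_strategy,
      exists2 k, k <= t & game_over G H (play sigma pi k).

(* "r is the online size Ramsey number of G and H": the least t for which
   Builder can end the game within t rounds. *)
Definition is_online_size_ramsey (G H : sgraph) (r : nat) : Prop :=
  builder_ends_within G H r /\
  forall t : nat, builder_ends_within G H t -> r <= t.

Lemma is_online_size_ramsey_uniq (G H : sgraph) (r s : nat) :
  is_online_size_ramsey G H r -> is_online_size_ramsey G H s -> r = s.
Proof.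
move=> [wr minr] [ws mins]; apply/eqP.
by rewrite eqn_leq (minr _ ws) (mins _ wr).
Qed.

(* Main.v *)
(* The red graph has no P_4, so an edge that would create one is forced to be
   blue.  Builder lengthens a blue path in phases, each asking at most a dozen
   edges at its two ends and at new vertices, and after each phase forgets
   everything but the path and at most two red edges.  Three kinds of positions
   suffice: the path alone (Bare), the path and a red edge away from its ends
   (Spare), and the path with a red star of two edges centred at one of its
   ends (Star).  The potential 5 t - 7 d of the t rounds left and the d vertices
   missing does not decrease beyond what the red edges of the new position are
   worth, whence 7/5 of a round per vertex; the exact additive constant comes
   from separate plans for the last few rounds.  The plans were found by
   computer search; their correctness is a finite computation. *)
Require Import Defs.
From HB Require Import structures.
From mathcomp Require Import all_boot all_order all_algebra.
From mathcomp Require Import zify.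
From Stdlib Require Import Classical ClassicalEpsilon.

Set Implicit Arguments.
Unset Strict Implicit.
Unset Printing Implicit Defensive.

Import Order.TTheory GRing.Theory Num.Theory.

(** * Least elements, sums and sorted lists *)

(** Turns an upper bound on the game length into an exact value; classical, as no decision procedure
    for [P] is assumed. *)
Lemma least_nat (P : nat -> Prop) (m : nat) :
  P m -> exists r, [/\ P r, r <= m & forall t, P t -> r <= t].
Proof.
elim/ltn_ind: m => m IHm Pm.
have [[k lt_km Pk]|min_m] := classic (exists2 k, k < m & P k).
  by have [r [Pr le_rk min_r]] := IHm k lt_km Pk; exists r; split => //; lia.
exists m; split=> // t Pt; rewrite leqNgt; apply/negP => lt_tm.
by apply: min_m; exists t.
Qed.

Lemma leq_sumn (s : seq nat) (x : nat) : x \in s -> x <= sumn s.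
Proof.
elim: s => //= y s IHs; rewrite in_cons => /predU1P[->|/IHs le_xs].
  exact: leq_addr.
exact: leq_trans le_xs (leq_addl _ _).
Qed.

Lemma has_ex (T : Type) (a : pred T) (s : seq T) : has a s -> exists x, a x.
Proof. by elim: s => //= x s IHs /orP[ax|/IHs //]; exists x. Qed.

Lemma sorted_cat_cons (T : Type) (e : rel T) (s t : seq T) (x : T) :
  sorted e (s ++ x :: t) = sorted e (rcons s x) && path e x t.
Proof. by case: s => //= y s; rewrite cat_path rcons_path /= andbA. Qed.

(** * Monochromatic paths on a board *)

Lemma joined_sym (b : board) (c : colour) : symmetric (joined b c).
Proof. by move=> u v; apply: eq_has => m; rewrite orbC. Qed.

Lemma path_copy (b : board) (c : colour) (q : seq nat) (n : nat) :
  uniq q -> sorted (joined b c) q -> n <= size q ->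
  has_copy b c (path_graph n).
Proof.
move=> uq sq le_nq; have lt_q (i : 'I_n) : i < size q by apply: leq_trans le_nq.
exists (fun i : 'I_n => nth 0 q i) => [i j /eqP | i j /= /orP[]/eqP eq_ij].
- by rewrite nth_uniq // => /eqP; apply: val_inj.
- by have/(sortedP 0)/(_ i) := sq; rewrite eq_ij; apply.
- by rewrite joined_sym; have/(sortedP 0)/(_ j) := sq; rewrite eq_ij; apply.
Qed.

(** Boards are compared through their coloured edges alone; the order of the rounds is forgotten. *)
Definition extends (b b' : board) : Prop :=
  forall c u v, joined b c u v -> joined b' c u v.

Lemma fresh_edge (b : board) : exists e : edge, e \notin selected b.
Proof.
(* The second component of an edge is its larger end, so [N] exceeds every vertex touched so far. *)
pose N := (sumn [seq (val e).2 | e <- selected b]).+1.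
exists (exist _ (0, N) (ltn0Sn _)); apply/negP => sel.
have := leq_sumn (map_f (fun e : edge => (val e).2) sel).
by rewrite /= ltnn.
Qed.

(** * The game as a recursion on the rounds left *)

Section Game.

Variables G H : sgraph.

(** Backward induction: alternating quantifiers over edges and colours replace strategies, so that
    Builder's plan can be assembled phase by phase. *)
Fixpoint wins (t : nat) (b : board) : Prop :=
  game_over G H b \/
  if t is t'.+1 then
    exists2 e, e \notin selected b & forall c, wins t' ((e, c) :: b)
  else False.

Lemma wins_over (t : nat) (b : board) : game_over G H b -> wins t b.
Proof. by case: t => [|t] over; left. Qed.

Lemma wins_leq (t t' : nat) (b : board) : t <= t' -> wins t b -> wins t' b.
Proof.
elim: t t' b => [|t IHt] t' b; first by move=> _ [over|//]; apply: wins_over.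
case: t' => // t' le_tt' [over|[e e_new We]]; first exact: wins_over.
by right; exists e => // c; apply: IHt (We c).
Qed.

(* An edge that is already on the board costs nothing: Builder skips the round
   and goes on as if Painter had just given it the colour that it has. *)
Lemma wins_ask (t : nat) (b : board) (u v : nat) :
    u != v ->
    (forall b' c, extends b b' -> joined b' c u v -> wins t b') ->
  wins t.+1 b.
Proof.
move=> neq_uv W.
have{neq_uv} [e De]: exists e : edge, (val e == (u, v)) || (val e == (v, u)).
  have := neq_uv; rewrite neq_ltn => /orP[] lt.
    by exists (exist _ (u, v) lt); rewrite /= eqxx.
  by exists (exist _ (v, u) lt); rewrite /= eqxx orbT.
have [/mapP[[e' c] m_b /= De']|e_new] := boolP (e \in selected b).
  apply: wins_leq (leqnSn t) _; apply: (W b c) => //.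
  by apply/hasP; exists (e', c) => //=; rewrite eqxx -De'.
right; exists e => // c; apply: (W _ c) => [c' x y /= -> |].
  by rewrite orbT.
by rewrite /= eqxx De.
Qed.

(** The number of rounds left can be read off the board as [t - size b], so choosing one good edge
    for each board yields a strategy. *)
Lemma wins_ends (t : nat) : wins t [::] -> builder_ends_within G H t.
Proof.
move=> Wt.
have /(_ _)/constructive_indefinite_description-sigmaP b : exists e : edge,
    e \notin selected b /\
    (~ game_over G H b -> wins (t - size b) b -> size b < t ->
     forall c, wins (t - (size b).+1) ((e, c) :: b)).
  have [[nover Wb lt_bt]|nW] :=
    classic [/\ ~ game_over G H b, wins (t - size b) b & size b < t].
    move: Wb; rewrite -subnSK // => -[//|[e e_new We]].
    by exists e; split=> // _ _ _ c; apply: We.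
  (* Where there is nothing to win, any unselected edge keeps the strategy legal. *)
  by have [e e_new] := fresh_edge b; exists e; split=> // *; case: nW.
pose sigma : builder_strategy := fun b => sval (sigmaP b).
exists sigma => [b | pi]; first by rewrite /sigma; case: (sigmaP b) => e [].
have size_play k : size (play sigma pi k) = k.
  by elim: k => //= k ->.
have [//|nover] :=
  classic (exists2 k, k <= t & game_over G H (play sigma pi k)).
(* As long as the game is not over, the chosen edge preserves [wins]; with no round left, [wins]
   means that the game is over. *)
suff W k : k <= t -> wins (t - k) (play sigma pi k).
  by exists t => //; have := W t (leqnn t); rewrite subnn => -[].
elim: k => [|k IHk] lt_kt; first by rewrite subn0.
rewrite /= {1}/sigma; case: (sigmaP _) => e /= [_ We].
rewrite -{1}(size_play k); apply: We; rewrite ?size_play //.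
  by move=> over; apply: nover; exists k => //; apply: ltnW.
exact/IHk/ltnW.
Qed.

End Game.

(** * Local positions and strategy trees *)

(* Positions between two phases.  Builder owns a blue path with ends 0 and 1
   (none at all in [Start]).  [Spare] has in addition a red edge 23 and [Star]
   the red edges 12 and 13; in both of them 3 may lie inside the path. *)
Inductive site := Start | Bare | Spare | Star.

Definition has_spine (s : site) : bool := if s is Start then false else true.

(* The labels that may denote vertices of the blue path. *)
Definition taken (s : site) : seq nat :=
  match s with
  | Start => [::]
  | Bare => [:: 0; 1]
  | Spare | Star => [:: 0; 1; 3]
  end.

Definition red_edges (s : site) : seq (nat * nat) :=
  match s with
  | Start | Bare => [::]
  | Spare => [:: (2, 3)]
  | Star => [:: (1, 2); (1, 3)]
  end.

(* [Ask u v Tr Tb] goes on with Tr if uv becomes red and with Tb if it becomes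
   blue.
   [Restart s l r rho] ends a phase: the blue path is prolonged by l on the side
   of 0 and by r on the side of 1, and label i of the new position s is rho_i;
   the labels beyond rho denote vertices not mentioned so far. *)
Inductive tree :=
  | RedPath of seq nat
  | Restart of site & seq nat & seq nat & seq nat
  | Ask of nat & nat & tree & tree.

Definition linked (E : seq (nat * nat)) : rel nat :=
  fun u v => ((u, v) \in E) || ((v, u) \in E).

(** The offset exceeds every entry of [rho] and every label that may lie on the prolonged path. Thus
    the map stays injective and new labels avoid the path. *)
Definition rename (s : site) (l r rho : seq nat) (i : nat) : nat :=
  if i < size rho then nth 0 rho i
  else (sumn (rho ++ taken s ++ l ++ r)).+1 + i.

(** Both lists are read from left to right along the path: [l] ends next to 0 and [r] starts next to
    1. With no path yet, [l] is the whole of it. *)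
Definition spine_links (s : site) (B : seq (nat * nat)) (l r : seq nat) :
    bool :=
  if has_spine s then
    sorted (linked B) (rcons l 0) && sorted (linked B) (1 :: r)
  else [&& l != [::], r == [::] & sorted (linked B) l].

(** The defaults 0 and 1 are the old ends, which stay ends on a side that is not prolonged. *)
Definition spine_ends (s : site) (l r : seq nat) : nat * nat :=
  (head 0 l, if has_spine s then last 1 r else last 0 l).

Definition restart_ok (s : site) (R B : seq (nat * nat))
    (s' : site) (l r rho : seq nat) : bool :=
  let: f := rename s l r rho in
  let: (x, y) := spine_ends s l r in
  [&& has_spine s', uniq (l ++ r), ~~ has (mem (taken s)) (l ++ r),
      spine_links s B l r,
      (* The path may be reversed, so a star can be centred at either end. *)
      ((f 0 == x) && (f 1 == y)) || ((f 0 == y) && (f 1 == x)),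
      uniq rho,
      all (fun i => (f i \in taken s ++ l ++ r) ==> (i \in taken s'))
          (iota 0 (size rho)) &
      all (fun e => linked R (f e.1) (f e.2)) (red_edges s')].

(* [P t g s'] says that Builder may be left with t rounds in position s' after
   having gained g vertices. *)
Fixpoint valid (P : nat -> nat -> site -> bool) (s : site)
    (R B : seq (nat * nat)) (t : nat) (T : tree) {struct T} : bool :=
  match T with
  | RedPath p => [&& size p == 4, uniq p & sorted (linked R) p]
  | Restart s' l r rho =>
      restart_ok s R B s' l r rho && P t (size l + size r) s'
  | Ask u v Tr Tb =>
      if t is t'.+1 then
        [&& u != v, valid P s ((u, v) :: R) B t' Tr
          & valid P s R ((u, v) :: B) t' Tb]
      else false
  end.

(** * Realising a local position on the board *)

Definition holds (b : board) (c : colour) (f : nat -> nat)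
    (E : seq (nat * nat)) : Prop :=
  forall u v, (u, v) \in E -> joined b c (f u) (f v).

(** Here [f] interprets labels as vertices and [q] is the actual blue path, whose length the labels
    do not record. The last field is only an implication because label 3 may lie on or off the
    path. *)
Record embeds (s : site) (b : board) (f : nat -> nat) (q : seq nat) : Prop :=
  Embeds {
    embeds_inj : injective f;
    embeds_uniq : uniq q;
    embeds_blue : sorted (joined b blue) q;
    embeds_ends :
      if has_spine s then [/\ q != [::], head 0 q = f 0 & last 0 q = f 1]
      else q = [::];
    embeds_taken : forall i, f i \in q -> i \in taken s }.

Lemma holds_linked (b : board) (c : colour) (f : nat -> nat)
    (E : seq (nat * nat)) (u v : nat) :
  holds b c f E -> linked E u v -> joined b c (f u) (f v).
Proof. by move=> hE /orP[/hE | /hE]; rewrite // joined_sym. Qed.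

Lemma holds_sorted (b : board) (c : colour) (f : nat -> nat)
    (E : seq (nat * nat)) (p : seq nat) :
  holds b c f E -> sorted (linked E) p -> sorted (joined b c) (map f p).
Proof.
move=> hE; rewrite sorted_map; apply: sub_sorted => u v.
exact: holds_linked.
Qed.

Lemma holds_extends (b b' : board) (c : colour) (f : nat -> nat)
    (E : seq (nat * nat)) :
  extends b b' -> holds b c f E -> holds b' c f E.
Proof. by move=> bb' hE u v /hE/bb'. Qed.

Lemma holds_cons (b : board) (c : colour) (f : nat -> nat)
    (E : seq (nat * nat)) (u v : nat) :
  joined b c (f u) (f v) -> holds b c f E -> holds b c f ((u, v) :: E).
Proof. by move=> juv hE x y; rewrite in_cons => /predU1P[[-> ->]|/hE]. Qed.

Lemma embeds_extends (s : site) (b b' : board) (f : nat -> nat) (q : seq nat) :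
  extends b b' -> embeds s b f q -> embeds s b' f q.
Proof.
move=> bb' [inj_f uq sq ends tq]; split=> //.
by apply: sub_sorted sq => u v /bb'.
Qed.

Lemma rename_inj (s : site) (l r rho : seq nat) :
  uniq rho -> injective (rename s l r rho).
Proof.
move=> u_rho i j; rewrite /rename.
have small k : k < size rho ->
    nth 0 rho k <= sumn (rho ++ taken s ++ l ++ r).
  by move=> lt_k; apply: leq_sumn; rewrite mem_cat mem_nth.
case: ltnP => [lt_i|_]; case: ltnP => [lt_j|_]; last by lia.
- by move/eqP; rewrite nth_uniq // => /eqP.
- by have := small _ lt_i; lia.
- by have := small _ lt_j; lia.
Qed.

(** The new path is [q] with the images of [l] and [r] attached, and the new interpretation is [f]
    composed with the renaming. *)
Lemma restart_sound (s s' : site) (R B : seq (nat * nat)) (l r rho : seq nat)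
    (b : board) (f : nat -> nat) (q : seq nat) :
    restart_ok s R B s' l r rho ->
    embeds s b f q -> holds b red f R -> holds b blue f B ->
  exists f' q', [/\ embeds s' b f' q', holds b red f' (red_edges s')
                  & size q' = size l + size r + size q].
Proof.
rewrite /restart_ok /=.
case/and5P=> sp' u_lr fresh links /and4P[ends u_rho /allP tk' /allP reds'].
move=> [inj_f uq sq endq tq] hR hB.
set rn := rename s l r rho in ends tk' reds'.
pose p := map f l ++ q ++ map f r.
have size_p : size p = size l + size r + size q.
  by rewrite !size_cat !size_map addnA addnAC.
have notq i : i \in l ++ r -> f i \notin q.
  move=> lr_i; apply/negP => /tq tk_i.
  by move/hasPn: fresh => /(_ i lr_i)/negP; apply.
have up : uniq p.
  rewrite /p uniq_catCA cat_uniq uq -map_cat map_inj_uniq // u_lr andbT /=.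
  by apply/hasPn => _ /mapP[i lr_i ->]; apply: notq.
have [p_n0 sp hp ep] : [/\ p != [::], sorted (joined b blue) p,
              head 0 p = f (spine_ends s l r).1
              & last 0 p = f (spine_ends s l r).2].
  move: links endq; rewrite /spine_links /spine_ends /p; case: (has_spine s).
    case/andP=> /(holds_sorted hB) sl /(holds_sorted hB) sr [].
    case: q sq {tq uq size_p notq up p} => // x q + _ /= Dx.
    rewrite {x}Dx => sq Dy.
    split.
    - by case: (map f l).
    - move: sl sr; rewrite sorted_cat_cons cat_path map_rcons /= Dy => -> ->.
      by rewrite andbT.
    - by case: (l).
    - by rewrite !last_cat /= last_cat Dy last_map.
  case/and3P=> l_n0 /eqP-> /(holds_sorted hB) sl ->.
  rewrite !cats0; split=> //.
  - by case: (l) l_n0.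
  - by case: (l) l_n0.
  - by case: (l) l_n0 => //= x l' _; rewrite last_map.
have tp i : f (rn i) \in p -> i \in taken s'.
  move=> p_i; have {p_i} t_i : rn i \in taken s ++ l ++ r.
    move: p_i; rewrite !mem_cat !(mem_map inj_f) => /or3P[->|/tq->|->] //;
    by rewrite ?orbT.
  have [lt_i|ge_i] := ltnP i (size rho).
    by apply: (implyP (tk' i _)); rewrite // mem_iota.
  (* Beyond [rho], a renamed label is larger than the sum of these labels, hence is none of them. *)
  suff: sumn (taken s ++ l ++ r) < rn i by rewrite ltnNge leq_sumn.
  rewrite /rn /rename (ltnNge i) ge_i (sumn_cat rho) addSn ltnS addnAC.
  exact: leq_addl.
exists (f \o rn).
have hR' : holds b red (f \o rn) (red_edges s').
  by move=> u v /reds'; apply: holds_linked.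
have inj' : injective (f \o rn) by apply: inj_comp => //; apply: rename_inj.
case/orP: ends => /andP[/eqP e0 /eqP e1].
  exists p; split=> //; split=> //; rewrite sp' /= e0 e1; split => //.
(* The ends match in the opposite order, so the path is read backwards. *)
exists (rev p); rewrite size_rev; split=> //; split=> //.
- by rewrite rev_uniq.
- by rewrite rev_sorted; apply: sub_sorted sp => u v; rewrite joined_sym.
- rewrite sp' /= e0 e1 -hp -ep; split.
  + by rewrite -size_eq0 size_rev size_eq0.
  + by case/lastP: (p) p_n0 => // p' x _; rewrite rev_rcons last_rcons.
  + by case: (p) p_n0 => // x p' _; rewrite rev_cons last_rcons.
- by move=> i; rewrite mem_rev; apply: tp.
Qed.

(** * Soundness of strategy trees *)

Section Soundness.

Variable n : nat.

Let W := wins (path_graph 4) (path_graph n).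

(** The [k] rounds beyond the budget [t] of the tree are handed on untouched, so a tree checked once
    for a fixed budget serves in arbitrarily long games. *)
Lemma valid_sound (P : nat -> nat -> site -> bool) (s : site) (k : nat)
    (R B : seq (nat * nat)) (t : nat) (T : tree)
    (b : board) (f : nat -> nat) (q : seq nat) :
    (forall t' g s' b' f' q', P t' g s' -> embeds s' b' f' q' ->
       holds b' red f' (red_edges s') -> size q' = g + size q ->
       W (k + t') b') ->
    valid P s R B t T ->
    embeds s b f q -> holds b red f R -> holds b blue f B ->
  W (k + t) b.
Proof.
move=> WP.
elim: T R B t b => [p | s' l r rho | u v Tr IHr Tb IHb] R B t b /=.
- case/and3P=> /eqP size_p up sp emb hR _; apply: wins_over; left.
  apply: (@path_copy _ _ (map f p)); last by rewrite size_map size_p.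
    by rewrite map_inj_uniq //; apply: embeds_inj emb.
  exact: holds_sorted sp.
- case/andP=> ok_p Pt emb hR hB.
  have [f' [q' [emb' hR' size_q']]] := restart_sound ok_p emb hR hB.
  exact: WP emb' hR' size_q'.
case: t => //= t /and3P[neq_uv Vr Vb] emb hR hB; rewrite addnS.
apply: (@wins_ask _ _ _ _ (f u) (f v)) => [|b' c bb' juv].
  by apply: contraNneq neq_uv => /(embeds_inj emb)->.
have emb' := embeds_extends bb' emb.
have hR' := holds_extends bb' hR; have hB' := holds_extends bb' hB.
by case: c juv => juv; [apply: IHr Vr _ _ _ | apply: IHb Vb _ _ _];
  rewrite //; apply: holds_cons.
Qed.

End Soundness.

(** * Builder's plans *)

(* The first plan of each position gains enough to be repeated for ever; the
   others are for the end of the game. *)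
Definition plans (s : site) : seq tree :=
  match s with
  | Start =>
   [::
      Ask 0 1 (Ask 1 2 (Ask 2 3 (RedPath [:: 0; 1; 2; 3]) (Ask 0 4
       (RedPath [:: 2; 1; 0; 4]) (Ask 2 4 (RedPath [:: 0; 1; 2; 4]) (Ask 5 6
       (Ask 6 1 (RedPath [:: 0; 1; 6; 5]) (Ask 5 7 (Ask 0 8
       (RedPath [:: 2; 1; 0; 8]) (Ask 8 6 (RedPath [:: 7; 5; 6; 8]) (Ask 1 5
       (RedPath [:: 0; 1; 5; 6])
       (Restart Star [:: 3; 2; 4; 0; 8; 6; 1; 5] [::] [:: 3; 5; 7; 6]))))
       (Ask 0 7 (RedPath [:: 2; 1; 0; 7]) (Ask 5 1 (RedPath [:: 0; 1; 5; 6])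
       (Ask 6 8
       (Restart Star [:: 3; 2; 4; 0; 7; 5; 1; 6] [::] [:: 3; 6; 8; 5])
       (Restart Bare [:: 3; 2; 4; 0; 7; 5; 1; 6; 8] [::] [:: 3; 8]))))))
       (Ask 0 6 (RedPath [:: 2; 1; 0; 6])
       (Restart Spare [:: 3; 2; 4; 0; 6; 5] [::] [:: 3; 5; 1; 0]))))))
       (Ask 1 3 (Ask 3 4 (RedPath [:: 0; 1; 3; 4]) (Ask 2 3
       (RedPath [:: 0; 1; 3; 2])
       (Restart Star [:: 4; 3; 2; 1] [::] [:: 4; 1; 0; 3])))
       (Restart Spare [:: 2; 1; 3] [::] [:: 2; 3; 0; 1])))
       (Restart Bare [:: 0; 1] [::] [:: 0; 1]);
      Ask 0 1 (Ask 1 2 (Ask 2 3 (RedPath [:: 0; 1; 2; 3]) (Ask 0 4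
       (RedPath [:: 2; 1; 0; 4]) (Ask 2 4 (RedPath [:: 0; 1; 2; 4]) (Ask 5 6
       (Ask 6 7 (Ask 1 6 (RedPath [:: 0; 1; 6; 5]) (Ask 0 8
       (RedPath [:: 2; 1; 0; 8]) (Ask 8 7 (RedPath [:: 5; 6; 7; 8]) (Ask 7 1
       (RedPath [:: 0; 1; 7; 6])
       (Restart Star [:: 3; 2; 4; 0; 8; 7; 1; 6] [::] [:: 3; 6; 5; 7])))))
       (Ask 0 7 (RedPath [:: 2; 1; 0; 7]) (Ask 6 1 (RedPath [:: 0; 1; 6; 5])
       (Ask 1 8 (Ask 8 9 (RedPath [:: 0; 1; 8; 9]) (Ask 1 5
       (RedPath [:: 0; 1; 5; 6]) (Ask 5 8 (RedPath [:: 0; 1; 8; 5])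
       (Restart Bare [:: 3; 2; 4; 0; 7; 6; 1; 5; 8; 9] [::] [:: 3; 9]))))
       (Restart Spare [:: 3; 2; 4; 0; 7; 6; 1; 8] [::] [:: 3; 8; 5; 6])))))
       (Ask 0 6 (RedPath [:: 2; 1; 0; 6])
       (Restart Spare [:: 3; 2; 4; 0; 6; 5] [::] [:: 3; 5; 1; 0]))))))
       (Ask 1 3 (Ask 3 4 (RedPath [:: 0; 1; 3; 4]) (Ask 2 3
       (RedPath [:: 0; 1; 3; 2])
       (Restart Star [:: 4; 3; 2; 1] [::] [:: 4; 1; 0; 3])))
       (Restart Spare [:: 2; 1; 3] [::] [:: 2; 3; 0; 1])))
       (Restart Bare [:: 0; 1] [::] [:: 0; 1]);
      Ask 0 1 (Ask 1 2 (Ask 2 3 (RedPath [:: 0; 1; 2; 3]) (Ask 0 4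
       (RedPath [:: 2; 1; 0; 4]) (Ask 2 5 (RedPath [:: 0; 1; 2; 5]) (Ask 5 0
       (RedPath [:: 2; 1; 0; 5])
       (Restart Spare [:: 3; 2; 5; 0; 4] [::] [:: 3; 4; 1; 0]))))) (Ask 1 3
       (Ask 3 4 (RedPath [:: 0; 1; 3; 4]) (Ask 2 3 (RedPath [:: 0; 1; 3; 2])
       (Restart Star [:: 4; 3; 2; 1] [::] [:: 4; 1; 0; 3])))
       (Restart Spare [:: 2; 1; 3] [::] [:: 2; 3; 0; 1])))
       (Restart Bare [:: 0; 1] [::] [:: 0; 1])]
  | Bare =>
   [::
      Ask 2 3 (Ask 3 4 (Ask 4 5 (RedPath [:: 2; 3; 4; 5]) (Ask 1 4
       (RedPath [:: 1; 4; 3; 2]) (Ask 5 2 (RedPath [:: 4; 3; 2; 5]) (Ask 6 7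
       (Ask 7 3 (RedPath [:: 2; 3; 7; 6]) (Ask 6 8 (Ask 2 9
       (RedPath [:: 4; 3; 2; 9]) (Ask 9 7 (RedPath [:: 8; 6; 7; 9]) (Ask 3 6
       (RedPath [:: 2; 3; 6; 7])
       (Restart Star [::] [:: 4; 5; 2; 9; 7; 3; 6] [:: 0; 6; 8; 7]))))
       (Ask 2 8 (RedPath [:: 4; 3; 2; 8]) (Ask 6 3 (RedPath [:: 2; 3; 6; 7])
       (Ask 7 9 (Restart Star [::] [:: 4; 5; 2; 8; 6; 3; 7] [:: 0; 7; 9; 6])
       (Restart Bare [::] [:: 4; 5; 2; 8; 6; 3; 7; 9] [:: 0; 9])))))) (Ask 2 7
       (RedPath [:: 4; 3; 2; 7])
       (Restart Spare [::] [:: 4; 5; 2; 7; 6] [:: 0; 6; 3; 2])))))) (Ask 1 3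
       (Ask 1 4 (RedPath [:: 2; 3; 1; 4])
       (Restart Star [::] [:: 4; 3] [:: 0; 3; 2; 1]))
       (Restart Spare [::] [:: 3; 4] [:: 0; 4; 2; 3]))) (Ask 1 4 (Ask 1 3
       (Ask 0 3 (RedPath [:: 0; 3; 1; 4])
       (Restart Star [:: 2; 3] [::] [:: 2; 1; 4; 3]))
       (Restart Spare [::] [:: 3; 2] [:: 0; 2; 4; 1])) (Ask 4 5 (Ask 4 3
       (Ask 0 3 (RedPath [:: 0; 3; 4; 5])
       (Restart Star [:: 2; 3] [:: 4] [:: 2; 4; 5; 3]))
       (Restart Spare [::] [:: 4; 3; 2] [:: 0; 2; 5; 4])) (Ask 5 6 (Ask 5 3
       (Ask 0 3 (RedPath [:: 0; 3; 5; 6])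
       (Restart Star [:: 2; 3] [:: 4; 5] [:: 2; 5; 6; 3]))
       (Restart Spare [::] [:: 4; 5; 3; 2] [:: 0; 2; 6; 5]))
       (Restart Bare [::] [:: 4; 5; 6] [:: 0; 6]))));
      Ask 1 2 (Ask 1 3 (Restart Star [::] [::] [:: 0; 1; 2; 3])
       (Restart Spare [::] [:: 3] [:: 0; 3; 2; 1]))
       (Restart Bare [::] [:: 2] [:: 0; 2]);
      Ask 1 2 (Ask 1 3 (Ask 3 4 (RedPath [:: 2; 1; 3; 4]) (Ask 0 3
       (RedPath [:: 0; 3; 1; 2])
       (Restart Star [:: 4; 3] [::] [:: 4; 1; 2; 3])))
       (Restart Spare [::] [:: 3] [:: 0; 3; 2; 1]))
       (Restart Bare [::] [:: 2] [:: 0; 2]);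
      Ask 2 3 (Ask 3 4 (Ask 4 5 (RedPath [:: 2; 3; 4; 5]) (Ask 2 6
       (RedPath [:: 4; 3; 2; 6]) (Ask 1 2 (RedPath [:: 1; 2; 3; 4]) (Ask 6 4
       (RedPath [:: 2; 3; 4; 6])
       (Restart Bare [::] [:: 2; 6; 4; 5] [:: 0; 5]))))) (Ask 1 3 (Ask 1 4
       (RedPath [:: 2; 3; 1; 4])
       (Restart Star [::] [:: 4; 3] [:: 0; 3; 2; 1]))
       (Restart Spare [::] [:: 3; 4] [:: 0; 4; 2; 3]))) (Ask 1 4 (Ask 1 3
       (Ask 0 3 (RedPath [:: 0; 3; 1; 4])
       (Restart Star [:: 2; 3] [::] [:: 2; 1; 4; 3]))
       (Restart Spare [::] [:: 3; 2] [:: 0; 2; 4; 1])) (Ask 4 3 (Ask 4 5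
       (Ask 0 3 (RedPath [:: 0; 3; 4; 5])
       (Restart Star [:: 2; 3] [:: 4] [:: 2; 4; 5; 3])) (Ask 5 3 (Ask 5 2
       (RedPath [:: 2; 5; 3; 4])
       (Restart Bare [::] [:: 4; 5; 2; 3] [:: 0; 3]))
       (Restart Bare [::] [:: 4; 5; 3; 2] [:: 0; 2])))
       (Restart Bare [::] [:: 4; 3; 2] [:: 0; 2])));
      Ask 1 2 (Ask 3 4 (Ask 4 5 (Ask 2 4 (RedPath [:: 1; 2; 4; 3]) (Ask 1 4
       (RedPath [:: 2; 1; 4; 3]) (Ask 5 6 (RedPath [:: 3; 4; 5; 6]) (Ask 3 7
       (RedPath [:: 5; 4; 3; 7]) (Ask 2 3 (RedPath [:: 1; 2; 3; 4]) (Ask 7 5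
       (RedPath [:: 3; 4; 5; 7])
       (Restart Bare [::] [:: 4; 2; 3; 7; 5; 6] [:: 0; 6]))))))) (Ask 1 3
       (RedPath [:: 2; 1; 3; 4]) (Ask 2 6 (Ask 3 2 (RedPath [:: 1; 2; 3; 4])
       (Ask 2 4 (RedPath [:: 1; 2; 4; 3]) (Ask 6 7 (RedPath [:: 1; 2; 6; 7])
       (Ask 5 6 (RedPath [:: 1; 2; 6; 5])
       (Restart Bare [::] [:: 3; 2; 4; 5; 6; 7] [:: 0; 7]))))) (Ask 3 6
       (Ask 3 2 (RedPath [:: 1; 2; 3; 4]) (Ask 6 7 (RedPath [:: 4; 3; 6; 7])
       (Ask 7 4 (RedPath [:: 6; 3; 4; 7])
       (Restart Bare [::] [:: 3; 2; 6; 7; 4; 5] [:: 0; 5])))) (Ask 2 5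
       (Ask 2 4 (RedPath [:: 1; 2; 4; 3]) (Ask 5 7 (RedPath [:: 1; 2; 5; 7])
       (Restart Bare [::] [:: 3; 6; 2; 4; 5; 7] [:: 0; 7]))) (Ask 4 7
       (Restart Star [::] [:: 3; 6; 2; 5; 4] [:: 0; 4; 7; 3])
       (Restart Bare [::] [:: 3; 6; 2; 5; 4; 7] [:: 0; 7]))))))) (Ask 1 5
       (Ask 0 5 (RedPath [:: 0; 5; 1; 2]) (Ask 5 4 (RedPath [:: 2; 1; 5; 4])
       (Restart Star [:: 3; 4; 5] [::] [:: 3; 1; 2; 5]))) (Ask 2 6 (Ask 5 6
       (RedPath [:: 1; 2; 6; 5]) (Ask 6 4 (RedPath [:: 1; 2; 6; 4])
       (Restart Spare [::] [:: 5; 6; 4; 3] [:: 0; 3; 2; 1]))) (Ask 5 4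
       (Ask 5 6 (Ask 5 2 (RedPath [:: 1; 2; 5; 4]) (Ask 6 7
       (RedPath [:: 4; 5; 6; 7]) (Ask 7 4 (RedPath [:: 6; 5; 4; 7])
       (Restart Bare [::] [:: 5; 2; 6; 7; 4; 3] [:: 0; 3])))) (Ask 2 3
       (Ask 2 4 (RedPath [:: 1; 2; 4; 5]) (Ask 3 7 (RedPath [:: 1; 2; 3; 7])
       (Restart Bare [::] [:: 5; 6; 2; 4; 3; 7] [:: 0; 7]))) (Ask 4 7
       (Restart Star [::] [:: 5; 6; 2; 3; 4] [:: 0; 4; 7; 5])
       (Restart Bare [::] [:: 5; 6; 2; 3; 4; 7] [:: 0; 7])))) (Ask 3 7
       (Ask 3 2 (RedPath [:: 1; 2; 3; 7])
       (Restart Spare [::] [:: 5; 4; 3; 2; 6] [:: 0; 6; 7; 3]))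
       (Restart Spare [::] [:: 5; 4; 3; 7] [:: 0; 7; 2; 1]))))))
       (Restart Bare [::] [:: 2] [:: 0; 2]);
      Ask 2 3 (Ask 3 4 (Ask 4 5 (RedPath [:: 2; 3; 4; 5]) (Ask 1 4
       (RedPath [:: 1; 4; 3; 2]) (Ask 5 2 (RedPath [:: 4; 3; 2; 5]) (Ask 6 7
       (Ask 7 8 (Ask 3 7 (RedPath [:: 2; 3; 7; 6]) (Ask 2 9
       (RedPath [:: 4; 3; 2; 9]) (Ask 9 8 (RedPath [:: 6; 7; 8; 9]) (Ask 8 3
       (RedPath [:: 2; 3; 8; 7])
       (Restart Star [::] [:: 4; 5; 2; 9; 8; 3; 7] [:: 0; 7; 6; 8])))))
       (Ask 2 8 (RedPath [:: 4; 3; 2; 8]) (Ask 7 3 (RedPath [:: 2; 3; 7; 6])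
       (Ask 3 9 (Ask 9 10 (RedPath [:: 2; 3; 9; 10]) (Ask 3 6
       (RedPath [:: 2; 3; 6; 7]) (Ask 6 9 (RedPath [:: 2; 3; 9; 6])
       (Restart Bare [::] [:: 4; 5; 2; 8; 7; 3; 6; 9; 10] [:: 0; 10]))))
       (Restart Spare [::] [:: 4; 5; 2; 8; 7; 3; 9] [:: 0; 9; 6; 7])))))
       (Ask 2 7 (RedPath [:: 4; 3; 2; 7])
       (Restart Spare [::] [:: 4; 5; 2; 7; 6] [:: 0; 6; 3; 2])))))) (Ask 1 3
       (Ask 1 4 (RedPath [:: 2; 3; 1; 4])
       (Restart Star [::] [:: 4; 3] [:: 0; 3; 2; 1]))
       (Restart Spare [::] [:: 3; 4] [:: 0; 4; 2; 3]))) (Ask 1 4 (Ask 1 3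
       (Ask 0 3 (RedPath [:: 0; 3; 1; 4])
       (Restart Star [:: 2; 3] [::] [:: 2; 1; 4; 3]))
       (Restart Spare [::] [:: 3; 2] [:: 0; 2; 4; 1])) (Ask 4 5 (Ask 4 3
       (Ask 0 3 (RedPath [:: 0; 3; 4; 5])
       (Restart Star [:: 2; 3] [:: 4] [:: 2; 4; 5; 3]))
       (Restart Spare [::] [:: 4; 3; 2] [:: 0; 2; 5; 4])) (Ask 5 6 (Ask 5 3
       (Ask 0 3 (RedPath [:: 0; 3; 5; 6])
       (Restart Star [:: 2; 3] [:: 4; 5] [:: 2; 5; 6; 3]))
       (Restart Spare [::] [:: 4; 5; 3; 2] [:: 0; 2; 6; 5]))
       (Restart Bare [::] [:: 4; 5; 6] [:: 0; 6]))));
      Ask 2 3 (Ask 3 4 (Ask 4 5 (RedPath [:: 2; 3; 4; 5]) (Ask 1 4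
       (RedPath [:: 1; 4; 3; 2]) (Ask 2 6 (RedPath [:: 4; 3; 2; 6]) (Ask 5 2
       (RedPath [:: 4; 3; 2; 5])
       (Restart Spare [::] [:: 4; 5; 2; 6] [:: 0; 6; 3; 2]))))) (Ask 1 3
       (Ask 1 4 (RedPath [:: 2; 3; 1; 4])
       (Restart Star [::] [:: 4; 3] [:: 0; 3; 2; 1]))
       (Restart Spare [::] [:: 3; 4] [:: 0; 4; 2; 3]))) (Ask 1 4 (Ask 1 3
       (Ask 0 3 (RedPath [:: 0; 3; 1; 4])
       (Restart Star [:: 2; 3] [::] [:: 2; 1; 4; 3]))
       (Restart Spare [::] [:: 3; 2] [:: 0; 2; 4; 1])) (Ask 4 5 (Ask 4 3
       (Ask 0 3 (RedPath [:: 0; 3; 4; 5])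
       (Restart Star [:: 2; 3] [:: 4] [:: 2; 4; 5; 3]))
       (Restart Spare [::] [:: 4; 3; 2] [:: 0; 2; 5; 4]))
       (Restart Bare [::] [:: 4; 5] [:: 0; 5])))]
  | Spare =>
   [::
      Ask 4 5 (Ask 2 6 (Ask 5 2 (RedPath [:: 3; 2; 5; 4]) (Ask 1 6
       (RedPath [:: 1; 6; 2; 3]) (Ask 4 7 (Ask 6 8 (RedPath [:: 3; 2; 6; 8])
       (Ask 8 5 (RedPath [:: 7; 4; 5; 8]) (Ask 2 4 (RedPath [:: 3; 2; 4; 5])
       (Restart Star [::] [:: 6; 8; 5; 2; 4] [:: 0; 4; 7; 5])))) (Ask 6 7
       (RedPath [:: 3; 2; 6; 7]) (Ask 4 2 (RedPath [:: 3; 2; 4; 5]) (Ask 5 8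
       (Restart Star [::] [:: 6; 7; 4; 2; 5] [:: 0; 5; 8; 4])
       (Restart Bare [::] [:: 6; 7; 4; 2; 5; 8] [:: 0; 8]))))))) (Ask 1 5
       (Ask 1 6 (RedPath [:: 4; 5; 1; 6]) (Ask 2 5 (RedPath [:: 1; 5; 2; 3])
       (Restart Star [::] [:: 6; 2; 5] [:: 0; 5; 4; 1]))) (Ask 5 2
       (RedPath [:: 3; 2; 5; 4])
       (Restart Spare [::] [:: 5; 2; 6] [:: 0; 6; 4; 5])))) (Ask 1 5 (Ask 1 2
       (RedPath [:: 3; 2; 1; 5]) (Ask 2 5 (RedPath [:: 1; 5; 2; 3])
       (Restart Bare [::] [:: 2; 5; 4] [:: 0; 4])))
       (Restart Spare [::] [:: 5; 4] [:: 0; 4; 2; 3]));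
      Ask 1 4 (Ask 1 2 (RedPath [:: 3; 2; 1; 4])
       (Restart Bare [::] [:: 2] [:: 0; 2]))
       (Restart Bare [::] [:: 4] [:: 0; 4]);
      Ask 1 4 (Ask 4 2 (RedPath [:: 1; 4; 2; 3]) (Ask 1 2
       (RedPath [:: 3; 2; 1; 4]) (Restart Bare [::] [:: 2; 4] [:: 0; 4])))
       (Restart Spare [::] [:: 4] [:: 0; 4; 2; 3]);
      Ask 1 4 (Ask 1 2 (RedPath [:: 3; 2; 1; 4]) (Ask 2 5 (Ask 5 6
       (RedPath [:: 3; 2; 5; 6]) (Ask 2 4 (RedPath [:: 1; 4; 2; 3]) (Ask 4 5
       (RedPath [:: 1; 4; 5; 2])
       (Restart Bare [::] [:: 2; 4; 5; 6] [:: 0; 6]))))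
       (Restart Spare [::] [:: 2; 5] [:: 0; 5; 4; 1])))
       (Restart Spare [::] [:: 4] [:: 0; 4; 2; 3]);
      Ask 4 5 (Ask 2 6 (Ask 1 6 (RedPath [:: 1; 6; 2; 3]) (Ask 5 7 (Ask 2 5
       (RedPath [:: 3; 2; 5; 4]) (Ask 6 8 (RedPath [:: 3; 2; 6; 8]) (Ask 8 7
       (RedPath [:: 4; 5; 7; 8]) (Ask 7 2 (RedPath [:: 2; 7; 5; 4])
       (Restart Star [::] [:: 6; 8; 7; 2; 5] [:: 0; 5; 4; 7]))))) (Ask 6 7
       (RedPath [:: 3; 2; 6; 7]) (Ask 5 2 (RedPath [:: 3; 2; 5; 4]) (Ask 2 8
       (Ask 8 9 (RedPath [:: 3; 2; 8; 9]) (Ask 2 4 (RedPath [:: 3; 2; 4; 5])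
       (Ask 4 8 (RedPath [:: 2; 8; 4; 5])
       (Restart Bare [::] [:: 6; 7; 5; 2; 4; 8; 9] [:: 0; 9]))))
       (Restart Spare [::] [:: 6; 7; 5; 2; 8] [:: 0; 8; 4; 5])))))) (Ask 1 5
       (Ask 1 6 (RedPath [:: 4; 5; 1; 6]) (Ask 4 7 (RedPath [:: 1; 5; 4; 7])
       (Ask 0 4 (RedPath [:: 0; 4; 5; 1]) (Ask 2 8 (Ask 8 9
       (RedPath [:: 3; 2; 8; 9]) (Ask 2 5 (RedPath [:: 1; 5; 2; 3]) (Ask 5 8
       (RedPath [:: 1; 5; 8; 2])
       (Restart Bare [:: 7; 4] [:: 6; 2; 5; 8; 9] [:: 7; 9]))))
       (Restart Spare [:: 7; 4] [:: 6; 2; 8] [:: 7; 8; 5; 1]))))) (Ask 5 2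
       (RedPath [:: 3; 2; 5; 4])
       (Restart Spare [::] [:: 5; 2; 6] [:: 0; 6; 4; 5])))) (Ask 1 5 (Ask 1 2
       (RedPath [:: 3; 2; 1; 5]) (Ask 2 5 (RedPath [:: 1; 5; 2; 3])
       (Restart Bare [::] [:: 2; 5; 4] [:: 0; 4])))
       (Restart Spare [::] [:: 5; 4] [:: 0; 4; 2; 3]));
      Ask 1 4 (Ask 4 2 (RedPath [:: 1; 4; 2; 3]) (Ask 1 2
       (RedPath [:: 3; 2; 1; 4]) (Ask 4 5
       (Restart Star [::] [:: 2; 4] [:: 0; 4; 5; 1])
       (Restart Bare [::] [:: 2; 4; 5] [:: 0; 5]))))
       (Restart Spare [::] [:: 4] [:: 0; 4; 2; 3])]
  | Star =>
   [::
      Ask 0 2 (RedPath [:: 0; 2; 1; 3]) (Ask 4 5 (Ask 5 6 (Ask 6 7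
       (RedPath [:: 4; 5; 6; 7]) (Ask 1 5 (RedPath [:: 2; 1; 5; 4]) (Ask 2 8
       (RedPath [:: 3; 1; 2; 8]) (Ask 8 6 (RedPath [:: 4; 5; 6; 8])
       (Restart Star [:: 7; 6; 8; 2] [:: 5] [:: 7; 5; 4; 6]))))) (Ask 1 4
       (RedPath [:: 2; 1; 4; 5]) (Ask 2 6 (RedPath [:: 3; 1; 2; 6]) (Ask 5 7
       (Ask 4 8 (RedPath [:: 7; 5; 4; 8])
       (Restart Star [:: 5; 6; 2] [:: 4; 8] [:: 8; 5; 7; 4])) (Ask 4 8
       (Restart Star [:: 7; 5; 6; 2] [:: 4] [:: 7; 4; 8; 5])
       (Restart Bare [:: 7; 5; 6; 2] [:: 4; 8] [:: 7; 8])))))) (Ask 2 5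
       (RedPath [:: 3; 1; 2; 5]) (Restart Bare [:: 4; 5; 2] [::] [:: 4; 1])));
      Ask 0 2 (RedPath [:: 0; 2; 1; 3]) (Restart Bare [:: 2] [::] [:: 2; 1]);
      Ask 2 4 (RedPath [:: 3; 1; 2; 4]) (Ask 0 2 (RedPath [:: 0; 2; 1; 3])
       (Restart Bare [:: 4; 2] [::] [:: 4; 1]));
      Ask 2 4 (RedPath [:: 3; 1; 2; 4]) (Ask 0 2 (RedPath [:: 0; 2; 1; 3])
       (Ask 1 5 (Restart Star [:: 4; 2] [::] [:: 4; 1; 5; 2])
       (Restart Bare [:: 4; 2] [:: 5] [:: 4; 5])));
      Ask 0 2 (RedPath [:: 0; 2; 1; 3]) (Ask 4 5 (Ask 5 6 (Ask 6 7
       (RedPath [:: 4; 5; 6; 7]) (Ask 1 5 (RedPath [:: 2; 1; 5; 4]) (Ask 2 8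
       (RedPath [:: 3; 1; 2; 8]) (Ask 8 6 (RedPath [:: 4; 5; 6; 8])
       (Restart Star [:: 7; 6; 8; 2] [:: 5] [:: 7; 5; 4; 6]))))) (Ask 2 6
       (RedPath [:: 3; 1; 2; 6]) (Ask 5 7 (Ask 7 8 (RedPath [:: 4; 5; 7; 8])
       (Ask 1 7 (RedPath [:: 1; 7; 5; 4])
       (Restart Star [:: 5; 6; 2] [:: 7; 8] [:: 8; 5; 4; 7]))) (Ask 1 8
       (Ask 8 9 (RedPath [:: 2; 1; 8; 9]) (Ask 1 4 (RedPath [:: 2; 1; 4; 5])
       (Ask 4 8 (RedPath [:: 1; 8; 4; 5])
       (Restart Bare [:: 7; 5; 6; 2] [:: 4; 8; 9] [:: 7; 9]))))
       (Restart Spare [:: 7; 5; 6; 2] [:: 8] [:: 7; 8; 4; 5]))))) (Ask 2 5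
       (RedPath [:: 3; 1; 2; 5]) (Restart Bare [:: 4; 5; 2] [::] [:: 4; 1])))]
  end.

(* In fifths of a round: the red edge of [Spare] saves Builder one of them, the
   star of [Star] six. *)
Definition weight (s : site) : nat :=
  match s with Start => 0 | Bare => 7 | Spare => 6 | Star => 1 end.

(* With t rounds left Builder can add d vertices to the path.  The two excluded
   pairs satisfy the inequality, but there is no plan for them. *)
Definition claim (s : site) (t d : nat) : bool :=
  (d == 0) ||
  (7 * d + weight s <= 5 * t + 5) &&
  match s with
  | Start => 13 <= t
  | Bare => (t, d) != (2, 1)
  | Spare => true
  | Star => (t, d) != (5, 4)
  end.

(** * Finite checks and the induction over phases *)

Definition sites : seq site := [:: Start; Bare; Spare; Star].

(** The condition [t' < t] makes the induction on rounds progress; [has_spine s'] rules out [Start],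
    whose claim has its own lower bound on the rounds. *)
Definition plan_exists (P : nat -> nat -> site -> bool) (s : site) (t : nat) :=
  has (valid (fun t' g s' => [&& t' < t, has_spine s' & P t' g s'])
             s (red_edges s) [::] t) (plans s).

(** For [t <= 16] a claim forces [7 * d <= 85], hence at most 12 missing vertices: the table is
    complete. *)
Lemma plans_few_rounds :
  all (fun s => all (fun t => all (fun d =>
    claim s t d.+1 ==>
      plan_exists (fun t' g s' => claim s' t' (d.+1 - g)) s t)
  (iota 0 12)) (iota 0 17)) sites.
Proof. by vm_compute. Qed.

(** One phase within 11 rounds: five per round used, plus the new weight, is covered by seven per
    vertex gained plus the old weight. This is the invariance of the inequality in [claim]. *)
Lemma plans_many_rounds :
  all (fun s =>
    plan_exists (fun t' g s' => 5 * (11 - t') + weight s' <= 7 * g + weight s)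
                s 11) sites.
Proof. by vm_compute. Qed.

Lemma all_sites (a : pred site) (s : site) : all a sites -> a s.
Proof. by case/and5P=> *; case: s. Qed.

Lemma claim_wins (n : nat) (s : site) (t d : nat) (b : board)
    (f : nat -> nat) (q : seq nat) :
    claim s t d -> embeds s b f q -> holds b red f (red_edges s) ->
    n <= size q + d ->
  wins (path_graph 4) (path_graph n) t b.
Proof.
elim/ltn_ind: t => t IHt in s d b f q *.
case: d => [_ [_ uq sq _ _] _|d claim_d emb hR le_n].
  by rewrite addn0 => le_n; apply: wins_over; right; apply: path_copy le_n.
(* The threshold is 11 + 6: from 17 rounds on, a phase leaves at least 6, so the excluded pairs with
   2 and 5 rounds cannot arise. *)
have [lt_t|ge_t] := ltnP t 17.
  have: plan_exists (fun t' g s' => claim s' t' (d.+1 - g)) s t.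
    have lt_d : d < 12.
      by move: claim_d; rewrite /claim /=; case: s {emb hR}; lia.
    have /allP/(_ t) := all_sites s plans_few_rounds.
    rewrite mem_iota => /(_ lt_t)/allP/(_ d); rewrite mem_iota => /(_ lt_d).
    by move/implyP; apply.
  case/has_ex=> T VT.
  apply: (@valid_sound n _ _ 0 _ _ _ _ _ _ _ _ VT emb hR) => //.
  move=> t' g s' b' f' q' /and3P[lt_t' _ claim'] emb' hR' size_q'.
  by apply: (IHt t' lt_t' s' (d.+1 - g)) emb' hR' _ => //; lia.
have /has_ex[T VT] := all_sites s plans_many_rounds.
rewrite -(subnK (leq_trans (isT : 11 <= 17) ge_t)).
apply: (@valid_sound n _ _ _ _ _ _ _ _ _ _ _ VT emb hR) => //.
move=> t' g s' b' f' q' /and3P[lt_t' sp' wt'] emb' hR' size_q'.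
apply: (IHt _ _ s' (d.+1 - g)) emb' hR' _; try by lia.
move: claim_d; rewrite /claim !xpair_eqE.
by case: s s' {emb hR VT} sp' wt' => [] [] //=; lia.
Qed.

(** * The bound for the empty board *)

Lemma start_wins (n t : nat) :
  7 * n <= 5 * t + 5 -> 13 <= t -> wins (path_graph 4) (path_graph n) t [::].
Proof.
move=> le_nt le_t; apply: (@claim_wins n Start t n [::] id [::]) => //.
  by rewrite /claim addn0 le_nt le_t orbT.
by split=> // i j.
Qed.

Theorem theorem1p4 (n : nat) (hn : (10 <= n)%N) :
  exists2 r : nat,
    is_online_size_ramsey (path_graph 4) (path_graph n) r &
    (r%:Z <= Num.ceil (7 / 5 * n%:R : rat) - 1)%R.
Proof.
(* The quotient is the ceiling of [7 * n / 5]; [n >= 10] gives [t >= 13], as the claim for [Start]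
   demands. *)
pose t := ((7 * n + 4) %/ 5).-1.
have Wt : builder_ends_within (path_graph 4) (path_graph n) t.
  by apply/wins_ends/start_wins; rewrite /t; lia.
have [r [Wr le_rt min_r]] := least_nat Wt.
exists r; first by split.
(* Being at most the ceiling minus one means being strictly below [7 * n / 5], that is
   [r * 5 < 7 * n] in the naturals. *)
rewrite lerBrDr lezD1 ceil_gt_int -pmulrn mulrAC ltr_pdivlMr // -!natrM ltr_nat.
by rewrite /t in le_rt; lia.
Qed.
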